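(* Let $\mathcal J$ be a $G_\delta$ ideal of compact subsets of a Polish space $X$, and let $\mathcal I$ be an $F_\sigma$ ideal of subsets of $\omega$ that is uncountably generated. Then $\mathcal I\not\leq_T \mathcal J$.
   Context: Both ideals are regarded as partial orders under inclusion. For directed partial orders $P,Q$, $P\leq_T Q$ ($P$ is Tukey reducible to $Q$) means there is a map $h\colon P\to Q$ sending unbounded (from above) subsets of $P$ to unbounded subsets of $Q$. An ideal of subsets of $\omega$ is $F_\sigma$ with respect to the product topology on $\mathcal P(\omega)=\{0,1\}^\omega$. An ideal of compact subsets of $X$ is a family of compact subsets of $X$ closed under taking compact subsets and finite unions; it is $G_\delta$ with respect to the Vietoris topology on the hyperspace $\mathcal K(X)$ of compact subsets of $X$. $\mathcal I$ is uncountably generated if there is no countable family $\mathcal C\subseteq\mathcal I$ such that every element of $\mathcal I$ is contained in some element of $\mathcal C$. *)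

(* Defs.v *)
From HB Require Import structures.
From mathcomp Require Import all_boot all_order all_algebra.
From mathcomp Require Import all_classical all_reals all_analysis.
From mathcomp Require Import borel_hierarchy.
Set Implicit Arguments.
Unset Strict Implicit.
Unset Printing Implicit Defensive.
Import Order.TTheory GRing.Theory Num.Theory.
Local Open Scope classical_set_scope.
Local Open Scope ring_scope.

Definition is_metric (R : realType) (X : Type) (d : X -> X -> R) : Prop :=
  [/\ forall x y, (d x y = 0) <-> (x = y),
      forall x y, d x y = d y x
    & forall x y z, d x z <= d x y + d y z].

Definition metrizes (R : realType) (X : topologicalType) (d : X -> X -> R) :
    Prop :=
  forall x : X,
    nbhs x = filter_from [set e : R | 0 < e] (fun e => [set y | d x y < e]).

Definition complete_metric (R : realType) (X : topologicalType)
    (d : X -> X -> R) : Prop :=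
  forall u : nat -> X,
    (forall e : R, 0 < e ->
       exists N, forall m n, (N <= m)%N -> (N <= n)%N -> d (u m) (u n) < e) ->
    exists l : X, u @ \oo --> l.

Definition separable_space (X : topologicalType) : Prop :=
  exists2 D : set X, countable D & dense D.

Definition polish (R : realType) (X : topologicalType) : Prop :=
  separable_space X /\
  exists d : X -> X -> R, [/\ is_metric d, metrizes d & complete_metric d].

(* The compact subsets of [X], the empty set included. *)
Definition hyperspace (X : topologicalType) : Type :=
  [set K : set X | compact K].

HB.instance Definition _ (X : topologicalType) := Choice.on (hyperspace X).

Definition vietoris_subbase (X : topologicalType) : set (set (hyperspace X)) :=
  [set V | exists2 U : set X, open U &
     V = [set K : hyperspace X | \val K `<=` U] \/
     V = [set K : hyperspace X | \val K `&` U !=set0]].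

HB.instance Definition _ (X : topologicalType) :=
  isSubBaseTopological.Build (hyperspace X) (@vietoris_subbase X) id.

Definition compact_ideal (X : topologicalType) (J : set (set X)) : Prop :=
  [/\ J `<=` compact,
      J set0,
      forall K L : set X, compact K -> K `<=` L -> J L -> J K
    & forall K L : set X, J K -> J L -> J (K `|` L)].

Definition Gdelta_family (X : topologicalType) (J : set (set X)) : Prop :=
  Gdelta [set K : hyperspace X | J (\val K)].

Definition omega_ideal (I : set (set nat)) : Prop :=
  [/\ I set0,
      forall A B : set nat, A `<=` B -> I B -> I A
    & forall A B : set nat, I A -> I B -> I (A `|` B)].

(* A point x of {0,1}^omega is the indicator function of [set n | x n]. *)
Definition Fsigma_family (I : set (set nat)) : Prop :=
  Fsigma [set x : cantor_space | I [set n | x n]].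

Definition uncountably_generated (I : set (set nat)) : Prop :=
  ~ exists C : set (set nat),
      [/\ countable C, C `<=` I & forall A, I A -> exists2 B, C B & A `<=` B].

Definition unbounded (P : Type) (le : P -> P -> Prop) (A : set P) : Prop :=
  ~ exists b : P, forall a, A a -> le a b.

Definition tukey_reducible (P Q : Type) (leP : P -> P -> Prop)
    (leQ : Q -> Q -> Prop) : Prop :=
  exists h : P -> Q, forall A : set P, unbounded leP A -> unbounded leQ (h @` A).

Definition inclusion_order (T : Type) (F : set (set T)) (A B : F) : Prop :=
  \val A `<=` \val B.
Arguments inclusion_order {T} F A B.

(* Main.v *)
Require Import Defs.
From HB Require Import structures.
From mathcomp Require Import finmap.
From mathcomp Require Import all_boot all_order all_algebra.
From mathcomp Require Import all_classical all_reals all_analysis.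
From mathcomp Require Import lra.

Set Implicit Arguments.
Unset Strict Implicit.
Unset Printing Implicit Defensive.
Import Order.TTheory GRing.Theory Num.Theory.
Local Open Scope classical_set_scope.

(** Let [h : I -> J] be a Tukey map.  Since [X] is second countable and [I] is
    not countably generated, some [K = h A] has the property that for every
    open [N] containing [K] the union of all [B] with [h B `<=` N] is outside
    [I].  As [I] is a countable union of compact sets [F j], finitely many of
    these [B] already have a union not contained in any element of
    [F 0, ..., F n].  The union of their images is an element of [J] inside
    [N].  Letting [N] shrink to [K], the sequence of elements of [J] obtained
    in this way converges to [K] from above, and because [J] is G_delta and
    closed under finite unions, the sets can be chosen so that their union
    together with [K] is compact and again in [J].  Its preimage under [h] is
    then bounded in [I], although no bound lies in any [F j]. *)

(** * Countable bases, compactness and Vietoris neighbourhoods *)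

Lemma metric_ball_open (R : realType) (X : topologicalType) (d : X -> X -> R)
    (x : X) (e : R) :
  is_metric d -> metrizes d -> open [set y | d x y < e]%R.
Proof.
move=> [_ _ dtri] dX; rewrite openE => y /= xye.
rewrite /interior dX; exists (e - d x y)%R => /=; first by rewrite subr_gt0.
move=> z /= yz; have := dtri x y z; lra.
Qed.

Lemma polish_countable_base (R : realType) (X : topologicalType) :
  polish R X ->
  exists B : nat -> set X, (forall n, open (B n)) /\
    forall (x : X) (U : set X), open U -> U x ->
      exists2 n, B n x & B n `<=` U.
Proof.
move=> [[D /countable_injP[g ginj] Ddense] [d [dm dX _]]].
(* As [g] is injective on [D], this is one ball or empty; the union avoids inverting [g], which
   would need a default point of [X]. *)
pose V (p : nat * nat) :=
  \bigcup_(x in [set x | D x /\ g x = p.1]) [set y | d x y < p.2.+1%:R^-1]%R.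
exists (fun k => oapp V set0 (unpickle k)); split => [k|x U oU Ux].
  case: (unpickle k) => [p|] /=; last exact: open0.
  by apply: bigcup_open => x _; exact: metric_ball_open.
have [dd0 dC dtri] := dm.
have : nbhs x U by exact: open_nbhs_nbhs.
rewrite dX => -[e /= e0 eU].
have [m me] : exists m : nat, (m.+1%:R^-1 < e / 2)%R.
  have e2 : (0 < e / 2)%R by rewrite divr_gt0.
  by have [m _ Hm] := near_infty_natSinv_lt (PosNum e2); exists m; apply: Hm => /=.
have [z [/= xz Dz]] : [set y | d x y < m.+1%:R^-1]%R `&` D !=set0.
  apply: Ddense; last exact: metric_ball_open.
  by exists x => /=; rewrite (dd0 x x).2 // invr_gt0.
exists (pickle (g z, m)); rewrite pickleK /=.
  by exists z => //=; rewrite dC.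
move=> y [z' /= [Dz' gz']]; rewrite (ginj z' z) ?inE//= => zy.
apply: eU => /=; move: (dtri x z y) xz zy me; set r := _^-1%R; lra.
Qed.

(* [compact_cover] is stated for pointed spaces only; [X] may be empty. *)
Lemma compact_coverP (X : topologicalType) (K : set X) :
  compact K <-> cover_compact K.
Proof.
have [[x _]|X0] := pselect (exists x : X, True).
  pose pX : ptopologicalType := HB.pack X (isPointed.Build X x).
  by rewrite -[compact K]/(@compact pX K) (@compact_cover pX).
have -> : K = set0 by apply/seteqP; split => x // _; apply: X0; exists x.
split=> _; last exact: compact0.
by move=> T D f _ _; exists fset0 => // i; rewrite inE.
Qed.

(** Finite unions of base sets, coded by [pickle], suffice: finitely many base sets inside [U]
    already cover [K]. *)
Lemma compact_countable_base (X : topologicalType) (B : nat -> set X) :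
  (forall n, open (B n)) ->
  (forall (x : X) (U : set X), open U -> U x ->
    exists2 n, B n x & B n `<=` U) ->
  exists W : nat -> set X, (forall n, open (W n)) /\
    forall K U : set X, compact K -> open U -> K `<=` U ->
      exists2 n, K `<=` W n & W n `<=` U.
Proof.
move=> Bo Bb.
pose W (s : seq nat) := \bigcup_(n in [set` s]) B n.
exists (fun k => oapp W set0 (unpickle k)); split => [k|K U cK oU KU].
  case: (unpickle k) => [s|] /=; last exact: open0.
  by apply: bigcup_open => n _.
move/compact_coverP: cK => /(_ nat [set n | B n `<=` U] B).
case=> [//|x Kx|D DU KD].
  by have [n Bx BU] := Bb x U oU (KU x Kx); exists n.
exists (pickle (enum_fset D)); rewrite pickleK /=.
  by move=> x /KD[n nD Bnx]; exists n.
move=> x [n nD Bnx]; have := DU n nD; rewrite inE; exact.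
Qed.

(** Intersecting the first neighbourhoods of [K] in the list makes the sequence decrease, so it
    stays inside [U] once some [W n] between [K] and [U] has been used. *)
Lemma compact_nbhs_seq (X : topologicalType) (W : nat -> set X) (K : set X) :
  (forall n, open (W n)) ->
  (forall U : set X, open U -> K `<=` U ->
    exists2 n, K `<=` W n & W n `<=` U) ->
  exists M : nat -> set X, [/\ forall n, open (M n), forall n, K `<=` M n &
    forall U : set X, open U -> K `<=` U ->
      exists n, forall m, (n <= m)%N -> M m `<=` U].
Proof.
move=> Wo Wb.
pose M n := \bigcap_(i in [set i | (i < n.+1)%N /\ K `<=` W i]) W i.
exists M; split.
- move=> n; pose W' i := if `[< K `<=` W i >] then W i else setT.
  have -> : M n = \big[setI/setT]_(i < n.+1) W' i.
    rewrite -bigcap_mkord; apply/seteqP; split => x Mx i /=.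
      by move=> il; rewrite /W'; case: asboolP => // KWi; exact: Mx.
    by move=> [il KWi]; have := Mx i il; rewrite /W'; case: asboolP.
  apply: big_ind => [|A C|i _]; [exact: openT|exact: openI|].
  by rewrite /W'; case: ifP => _; [exact: Wo|exact: openT].
- by move=> n x Kx i [_]; exact.
- move=> U oU KU; have [n KW WU] := Wb U oU KU.
  by exists n => m nm x Mx; apply/WU/Mx; split.
Qed.

(** A finite subcover of [K] covers everything outside a single [L n], which is itself compact. *)
Lemma bigcup_compact_accumulating (X : topologicalType) (L : nat -> set X)
    (K : set X) :
  compact K -> (forall n, compact (L n)) ->
  (forall U : set X, open U -> K `<=` U ->
    exists n, \bigcup_i L i `<=` U `|` L n) ->
  K `<=` \bigcup_i L i ->
  compact (\bigcup_i L i).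
Proof.
move=> /compact_coverP cK cL tail KL; apply/compact_coverP => T D f fo Lf.
have [D1 D1D KD1] := cK T D f fo (subset_trans KL Lf).
have oU : open (cover [set` D1] f).
  by apply: bigcup_open => i iD1; apply: fo; apply/set_mem/D1D.
have [n LU] := tail _ oU KD1.
have [D2 D2D LD2] := (compact_coverP (L n)).1 (cL n) T D f fo
  (subset_trans (@bigcup_sup _ _ _ _ L I) Lf).
exists (D1 `|` D2)%fset; first by move=> i /fsetUP[/D1D|/D2D].
move=> x /LU[[i iD fx]|/LD2[i iD fx]]; exists i => //=; apply/fsetUP;
  [by left|by right].
Qed.

(* Between [L0] and larger compact sets only the upper Vietoris topology
   matters: sets containing [L0] meet every open set that [L0] meets. *)
Lemma vietoris_open_above (X : topologicalType) (O : set (hyperspace X))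
    (L0 : hyperspace X) :
  open O -> O L0 ->
  exists U : set X, [/\ open U, \val L0 `<=` U &
    forall L : hyperspace X, \val L0 `<=` \val L -> \val L `<=` U -> O L].
Proof.
move=> [D' sD' <-] [A AD' AL0].
have [F FV FA] := sD' A AD'.
have FL0 : (\bigcap_(V in [set` F]) V) L0 by rewrite FA.
suff [U [oU L0U HU]] : exists U : set X, [/\ open U, \val L0 `<=` U &
    forall L : hyperspace X, \val L0 `<=` \val L -> \val L `<=` U ->
      forall V, V \in enum_fset F -> V L].
  exists U; split => // L L0L LU; exists A => //.
  suff : A L by [].
  by rewrite -FA => V VF; exact: (HU L).
have {FV}FV V : V \in enum_fset F -> vietoris_subbase V /\ V L0.
  by move=> VF; split; [exact/set_mem/FV|exact: FL0].
elim: (enum_fset F) FV => [|V s IH] FV.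
  by exists setT; split; [exact: openT|by []|move=> L _ _ V; rewrite in_nil].
have [U [oU L0U HU]] : exists U : set X, [/\ open U, \val L0 `<=` U &
    forall L : hyperspace X, \val L0 `<=` \val L -> \val L `<=` U -> V L].
  have [[U oU [->|->]] VL0] := FV V (mem_head _ _).
    by exists U; split.
  exists setT; split; [exact: openT|by []|move=> L L0L _ /=].
  by case: VL0 => x [/L0L Lx Ux]; exists x.
have [|U' [oU' L0U' HU']] := IH.
  by move=> V' V's; apply: FV; rewrite inE V's orbT.
exists (U `&` U'); split; first exact: openI.
- by move=> x L0x; split; [exact: L0U|exact: L0U'].
- move=> L L0L LUU' V'; rewrite inE => /orP[/eqP ->|V's].
    by apply: HU => // x /LUU'[].
  by apply: (HU' L) => // x /LUU'[].
Qed.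

(** * Consequences of the F_sigma and G_delta hypotheses *)

Lemma closed_cantor_superset (F : set cantor_space) (C : set nat) :
  closed F ->
  (forall m, exists2 x, F x & forall c, (c < m)%N -> C c -> x c) ->
  exists2 x, F x & forall c, C c -> x c.
Proof.
move=> cF HF.
have [x xF] := choice (fun m => (exists2P _ _).1 (HF m)).
have cpF : compact F.
  exact: (subclosed_compact cF cantor_space_compact).
(* A cluster point of the approximations works: for [c] in [C], coordinate [c] is eventually true
   along [x]. *)
have [|y [Fy yx]] := cpF (x @ \oo) _.
  by exists 0%N => // m _ /=; have [] := xF m.
exists y => // c Cc.
have yc : nbhs y [set z : cantor_space | z c = y c].
  have /(_ y [set b | b = y c]) := @proj_continuous nat (fun=> bool) c.
  by apply; exact: discrete_set1.
have Hx : (x @ \oo) [set z | z c].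
  by exists c.+1 => // m cm /=; have [_] := xF m; apply.
by have [z [/= zc <-]] := yx _ _ Hx yc.
Qed.

(** If all finite parts of [C] had supersets in one [F j], compactness would give a superset of all
    of [C] there, putting [C] in [I]. The maximum of the bounds for [j <= n] serves them all. *)
Lemma Fsigma_ideal_finite_part (I : set (set nat))
    (F : (set cantor_space)^nat) (C : set nat) (n : nat) :
  omega_ideal I -> (forall i, closed (F i)) ->
  [set x : cantor_space | I [set k | x k]] = \bigcup_i F i ->
  ~ I C ->
  exists m, forall j x, (j <= n)%N -> F j x ->
    ~ (forall c, (c < m)%N -> C c -> x c).
Proof.
move=> [_ Isub _] Fcl IF nIC.
have H j : exists m, forall x, F j x -> ~ (forall c, (c < m)%N -> C c -> x c).
  apply: contrapT => /forallNP nm; apply: nIC.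
  have [|x Fx Cx] := closed_cantor_superset (C := C) (Fcl j).
    move=> m; have /existsNP[x /not_implyP[Fx /contrapT xC]] := nm m.
    by exists x.
  apply: (Isub _ [set k | x k]) => //.
  by rewrite -[I _]/([set x : cantor_space | I [set k | x k]] x) IF; exists j.
have [m Hm] := choice H.
exists (\max_(j < n.+1) m j) => j x jn Fx xC; apply: (Hm j x Fx) => c cm.
apply: xC; apply: leq_trans cm _.
exact: (@leq_bigmax _ (fun j : 'I_n.+1 => m j) (Ordinal (jn : (j < n.+1)%N))).
Qed.

Lemma Gdelta_family_above (X : topologicalType) (J : set (set X)) :
  J `<=` compact -> Gdelta_family J ->
  exists G : nat -> set (set X),
    (forall L i, J L -> exists U : set X, [/\ open U, L `<=` U &
      forall L', compact L' -> L `<=` L' -> L' `<=` U -> G i L']) /\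
    (forall L, compact L -> (forall i, G i L) -> J L).
Proof.
move=> Jc [V Vo JV]; exists (fun i => (\val : hyperspace X -> set X) @` V i).
split=> [L i JL|L cL GL].
  pose hL : hyperspace X := exist _ L (mem_set (Jc L JL)).
  have VL : V i hL.
    have : [set K : hyperspace X | J (\val K)] hL by [].
    by rewrite JV; exact.
  have [U [oU LU HU]] := vietoris_open_above (Vo i) VL.
  exists U; split => // L' cL' LL' L'U.
  by exists (exist _ L' (mem_set cL')) => //; apply: HU.
pose hL : hyperspace X := exist _ L (mem_set cL).
suff : [set K : hyperspace X | J (\val K)] hL by [].
rewrite JV => i _; have [H VH HL] := GL i.
have <- : H = hL; last by [].
exact: val_inj.
Qed.

(** * Preimages under a map between the ideals *)

(** Otherwise every [N] can be shrunk to some [W n], and those unions [c n] that lie in [I] form a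
    countable cofinal family. *)
Lemma tukey_unbounded_preimage (X : topologicalType) (J : set (set X))
    (I : set (set nat)) (W : nat -> set X) (h : I -> J) :
  (forall K U : set X, compact K -> open U -> K `<=` U ->
    exists2 n, K `<=` W n & W n `<=` U) ->
  J `<=` compact -> omega_ideal I -> uncountably_generated I ->
  exists A : I, forall N : set X, open N -> \val (h A) `<=` N ->
    ~ I (\bigcup_(B in [set B : I | \val (h B) `<=` N]) \val B).
Proof.
move=> Wb Jc [_ Isub _] Iunc; apply: contrapT => /forallNP noA; apply: Iunc.
pose c n := \bigcup_(B in [set B : I | \val (h B) `<=` W n]) \val B.
exists (c @` [set n | I (c n)]); split.
- apply: sub_countable (card_image_le _ _) _; exact: countableP.
- by move=> _ [n In <-].
move=> A IA; pose A' : I := exist _ A (mem_set IA).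
have /existsNP[N /not_implyP[oN /not_implyP[hN /contrapT IN]]] := noA A'.
have [n hW WN] := Wb _ N (Jc _ (set_valP (h A'))) oN hN.
exists (c n); last by move=> k Ak; exists A'.
exists n => //; apply: Isub IN => k [B /= hB Bk].
by exists B => //= ; exact: subset_trans WN.
Qed.

(** One witness [B] for each relevant [k] is enough, and a finite union of sets [h B] stays in
    [J]. *)
Lemma ideal_finite_trace (X : topologicalType) (J : set (set X))
    (I : set (set nat)) (h : I -> J) (N : set X) (m : nat) :
  compact_ideal J ->
  exists L : set X, [/\ J L, L `<=` N &
    forall k, (k < m)%N ->
      (\bigcup_(B in [set B : I | \val (h B) `<=` N]) \val B) k ->
      exists2 B : I, \val (h B) `<=` L & \val B k].
Proof.
move=> [_ J0 _ JU]; elim: m => [|m [L [JL LN HL]]]; first by exists set0; split.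
have [[B /= hB Bm]|nm] :=
  pselect ((\bigcup_(B in [set B : I | \val (h B) `<=` N]) \val B) m).
  exists (L `|` \val (h B)); split.
  - by apply: JU => //; exact: set_valP.
  - by move=> x [/LN|/hB].
  move=> k; rewrite ltnS leq_eqVlt => /orP[/eqP -> _|km /(HL k km)[B' hB' B'k]].
    by exists B => // x; right.
  by exists B' => // x /hB'; left.
exists L; split => // k; rewrite ltnS leq_eqVlt => /orP[/eqP ->//|km].
exact: HL.
Qed.

Theorem theorem2p1 (R : realType) (X : topologicalType)
    (J : set (set X)) (I : set (set nat)) :
  polish R X ->
  compact_ideal J -> Gdelta_family J ->
  omega_ideal I -> Fsigma_family I -> uncountably_generated I ->
  ~ tukey_reducible (inclusion_order I) (inclusion_order J).
Proof.
move=> /polish_countable_base[B0 [B0o B0b]] Jid JG Iid [F Fcl IF] Iunc [h hT].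
have [Jc _ Jsub JU] := Jid.
have [W [Wo Wb]] := compact_countable_base B0o B0b.
have [A HA] := tukey_unbounded_preimage h Wb Jc Iid Iunc.
set K := \val (h A) in HA.
have JK : J K by exact: set_valP.
have [M [Mo KM Mb]] := compact_nbhs_seq Wo (fun U => Wb K U (Jc K JK)).
have [G [Gabove GJ]] := Gdelta_family_above Jc JG.
(* No member of [F 0], ..., [F i] bounds the preimage of [L]; this passes to every larger [L]. *)
pose bad i L := forall (x : cantor_space) j, (j <= i)%N -> F j x ->
  ~ forall B : I, \val (h B) `<=` L -> \val B `<=` [set k | x k].
have Hbad i N : open N -> K `<=` N -> exists L, [/\ J L, L `<=` N & bad i L].
  move=> oN KN.
  have [m Hm] := Fsigma_ideal_finite_part i Iid Fcl IF (HA N oN KN).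
  have [L [JL LN HL]] := ideal_finite_trace h N m Jid.
  exists L; split => // x j ji Fx Bx; apply: (Hm j x ji Fx) => k km /(HL k km).
  by move=> [B hB Bk]; exact: (Bx B hB).
(* [s.1] is the set built so far and [s.2] an open set confining all later ones, so that the final
   union still falls in [G i]. *)
pose inv i (s : set X * set X) := [/\ J s.1, open s.2, K `<=` s.1, s.1 `<=` s.2 &
  forall L, compact L -> s.1 `<=` L -> L `<=` s.2 -> G i L].
pose next i (s t : set X * set X) := [/\ s.1 `<=` t.1, t.2 `<=` s.2,
  t.1 `<=` s.1 `|` M i & bad i t.1].
(* The invariant sits under the existential so that [choice] yields a total function; where it
   fails, any pair will do. *)
have step (p : nat * (set X * set X)) : exists t, inv p.1 p.2 ->
    inv p.1.+1 t /\ next p.1 p.2 t.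
  case: p => i [L N] /=.
  have [[/= JL oN KL LN LG]|ninv] := pselect (inv i (L, N)); last by exists (L, N).
  have [L' [JL' L'NM badL']] : exists L', [/\ J L', L' `<=` N `&` M i & bad i L'].
    apply: Hbad; first exact: openI.
    by move=> x Kx; split; [exact/LN/KL|exact: KM].
  have JLL' : J (L `|` L') by exact: JU.
  have [U [oU LU UG]] := Gabove _ i.+1 JLL'.
  exists (L `|` L', N `&` U) => _; split; split => //=.
  - exact: openI.
  - by move=> x /KL; left.
  - by move=> x LL'x; split; [case: LL'x => [/LN|/L'NM[]]|exact: LU].
  - by move=> L'' cL'' LL'' L''NU; apply: UG => // x /L''NU[].
  - by move=> x [|/L'NM[]]; [left|right].
  - move=> x j ji Fx HB; apply: (badL' x j ji Fx) => B hB; apply: HB => y /hB.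
    by right.
have [f Hf] := choice step.
have [U0 [oU0 KU0 U0G]] := Gabove K 0 JK.
pose S := fix S n := if n is k.+1 then f (k, S k) else (K, U0).
have Sinv i : inv i (S i).
  by elim: i => [|i IH]; [split|exact: (Hf (i, S i) IH).1].
have Snext i : next i (S i) (S i.+1) by exact: (Hf (i, S i) (Sinv i)).2.
have Lmono i j : (i <= j)%N -> (S i).1 `<=` (S j).1.
  move=> /subnKC <-; elim: (j - i)%N => [|k IH]; first by rewrite addn0.
  by rewrite addnS; have [+ _ _ _] := Snext (i + k)%N; exact: subset_trans.
have Nmono i j : (i <= j)%N -> (S j).2 `<=` (S i).2.
  move=> /subnKC <-; elim: (j - i)%N => [|k IH]; first by rewrite addn0.
  rewrite addnS; have [_ + _ _] := Snext (i + k)%N => /subset_trans; exact.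
pose L := \bigcup_i (S i).1.
have cL : compact L.
  apply: (@bigcup_compact_accumulating _ (fun i => (S i).1) K).
  - exact: Jc.
  - by move=> i; have [JS _ _ _ _] := Sinv i; exact: Jc.
  (* Whatever is added after stage [n] lies in some [M m] with [n <= m], hence in [U]. *)
  - move=> U oU KU; have [n Mn] := Mb U oU KU; exists n => x [i _].
    have [/Lmono Lin /Lin|/ltnW/subnKC <-] := leqP i n; first by right.
    elim: (i - n)%N => [|k IH]; first by rewrite addn0; right.
    rewrite addnS; have [_ _ + _] := Snext (n + k)%N => /[apply] -[//|Mx].
    by left; apply: Mn Mx; exact: leq_addr.
  - by move=> x Kx; exists 0%N.
have JL : J L.
  apply: GJ => // i; have [_ _ _ _] := Sinv i; apply => //.
    exact: (@bigcup_sup _ _ _ _ (fun i => (S i).1)).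
  (* To see that [L] stays inside [(S i).2], compare stages [i] and [j] at their maximum: first
     components grow, second ones shrink. *)
  move=> x [j _ Sx]; apply: (Nmono i (maxn i j) (leq_maxl _ _)).
  have [_ _ _ + _] := Sinv (maxn i j); apply.
  exact: (Lmono j (maxn i j) (leq_maxr _ _)) Sx.
pose preL := [set B : I | \val (h B) `<=` L].
(* [L] bounds the image of [preL] in [J], so the Tukey property bounds [preL] in [I]. *)
have [b Hb] : exists b : I, forall B, preL B -> inclusion_order I B b.
  apply: contrapT => /hT; apply; exists (exist _ L (mem_set JL)).
  by move=> _ [B hB <-].
pose x : cantor_space := fun k => `[< \val b k >].
have xE : [set k | x k] = \val b by apply/seteqP; split=> k /asboolP.
(* The bound lies in some [F j], but [(S j.+1).1], a subset of [L], is bad for [j]. *)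
have : (\bigcup_i F i) x by rewrite -IF /= xE; exact: set_valP.
move=> [j _ Fx]; have [_ _ _ /(_ x j (leqnn j) Fx)] := Snext j; apply.
move=> B hB; rewrite xE; apply: Hb => y /hB Ly; by exists j.+1.
Qed.
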